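(* Let $A$ be an algebra over a field $K$ of characteristic zero, let $\delta_1,\ldots,\delta_s$ be commuting locally nilpotent $K$-derivations of $A$, and let $x_1,\ldots,x_s\in A$ satisfy $\delta_i(x_j)=\delta_{ij}$ (the Kronecker delta) for all $i,j$. Let $\sigma\in\mathrm{Aut}_K(A)$ satisfy $\sigma(A^\delta)=A^\delta$, let $\sigma_\delta:=\sigma|_{A^\delta}\in\mathrm{Aut}_K(A^\delta)$, and put $x_i':=\sigma(x_i)$, $\delta_i':=\sigma\delta_i\sigma^{-1}$. Then, for every $a\in A$, $$\sigma^{-1}(a)=\sum_{\alpha\in\mathbb N^s}x^\alpha\,\sigma_\delta^{-1}\phi_\sigma\Big(\frac{(\delta')^\alpha}{\alpha!}a\Big)=\sum_{\alpha\in\mathbb N^s}\sigma_\delta^{-1}\psi_\sigma\Big(\frac{(\delta')^\alpha}{\alpha!}a\Big)x^\alpha.$$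
   Context: Algebras are associative and unital, not necessarily commutative; $\mathbb N=\{0,1,\ldots\}$. A derivation is locally nilpotent if each element is killed by some power of it. $A^\delta=\bigcap_{i=1}^s\ker\delta_i$; $x^\alpha=x_1^{\alpha_1}\cdots x_s^{\alpha_s}$; $\alpha!=\alpha_1!\cdots\alpha_s!$; $(\delta')^\alpha=(\delta_1')^{\alpha_1}\cdots(\delta_s')^{\alpha_s}$. The $\delta_i'$ are commuting locally nilpotent derivations of $A$ with $\delta_i'(x_j')=\delta_{ij}$. Define $\phi_i'(a)=\sum_{k\ge0}(-1)^k\frac{(x_i')^k}{k!}(\delta_i')^k(a)$ and $\psi_i'(a)=\sum_{k\ge0}(-1)^k(\delta_i')^k(a)\frac{(x_i')^k}{k!}$ for $a\in A$, and $\phi_\sigma=\phi_s'\phi_{s-1}'\cdots\phi_1'$, $\psi_\sigma=\psi_1'\psi_2'\cdots\psi_s'$ (compositions); both map $A$ onto $A^\delta$. *)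

(* Defs.v *)
From HB Require Import structures.
From mathcomp Require Import all_boot all_order all_algebra.
From mathcomp Require Import finmap mathcomp_extra boolp classical_sets functions.
From mathcomp Require Import cardinality fsbigop.

Set Implicit Arguments.
Unset Strict Implicit.
Unset Printing Implicit Defensive.

Import GRing.Theory.
Local Open Scope classical_set_scope.
Local Open Scope ring_scope.

(* [F] has finite support and [v] is the sum of its values.  The operator
   [\sum_(i \in _)] alone returns 0 on families of infinite support. *)
Definition is_finsum (I : choiceType) (V : nmodType) (F : I -> V) (v : V) :
    Prop :=
  finite_set [set i | F i != 0] /\ v = \sum_(i \in [set: I]) F i.

Record derivation (K : fieldType) (A : algType K) := Derivation {
  der_fun :> {linear A -> A};
  derM : forall a b, der_fun (a * b) = der_fun a * b + a * der_fun b
}.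

Definition locally_nilpotent (K : fieldType) (A : algType K)
    (d : derivation A) : Prop :=
  forall a, exists n, iter n d a = 0.

(* Aut_K(A), an automorphism being carried together with its inverse. *)
Record algAut (K : fieldType) (A : algType K) := AlgAut {
  aut_fun :> {lrmorphism A -> A};
  aut_inv : A -> A;
  aut_funK : cancel aut_fun aut_inv;
  aut_invK : cancel aut_inv aut_fun
}.

Section Invariants.
Variables (K : fieldType) (A : algType K) (s : nat).
Variable delta : 'I_s -> derivation A.

(* A^delta, as a predicate on A and as a K-algebra. *)
Definition invariants : {pred A} := [pred a | [forall i, delta i a == 0]].

Lemma invariantsP a : reflect (forall i, delta i a = 0) (a \in invariants).
Proof. by rewrite inE; apply: (iffP forallP) => h i; apply/eqP. Qed.

Lemma der1 (d : derivation A) : d 1 = 0.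
Proof.
have := derM d 1 1; rewrite !mul1r mulr1 => h.
by apply: (addrI (d 1)); rewrite addr0.
Qed.

Fact invariants_subalg : subalg_closed invariants.
Proof.
split; first by apply/invariantsP => i; rewrite der1.
- move=> k a b /invariantsP ha /invariantsP hb; apply/invariantsP => i.
  by rewrite linearP ha hb scaler0 addr0.
- move=> a b /invariantsP ha /invariantsP hb; apply/invariantsP => i.
  by rewrite derM ha hb mul0r mulr0 addr0.
Qed.
HB.instance Definition _ :=
  GRing.isSubalgClosed.Build K A invariants 
    (GRing.subalg_closed_semi invariants_subalg).

Record inv_alg := InvAlg { inv_val : A; inv_valP : inv_val \in invariants }.
HB.instance Definition _ := [isSub for inv_val].
HB.instance Definition _ := [Choice of inv_alg by <:].
HB.instance Definition _ := [SubChoice_isSubAlgebra of inv_alg by <:].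

(* Corestriction of elements of A to A^delta; only meant for elements of
   A^delta, the default value 0 being used elsewhere. *)
Definition to_inv (a : A) : inv_alg := insubd 0 a.

Lemma to_invK a : a \in invariants -> val (to_inv a) = a.
Proof. by move=> ha; rewrite insubdK. Qed.

End Invariants.

Section Restriction.
Variables (K : fieldType) (A : algType K) (s : nat).
Variables (delta : 'I_s -> derivation A) (sigma : algAut A).

Definition stabilizes : Prop :=
  sigma @` [set` invariants delta] = [set` invariants delta].

Hypothesis hs : stabilizes.

Lemma restr_in (a : inv_alg delta) : sigma (val a) \in invariants delta.
Proof.
suff: [set` invariants delta] (sigma (val a)) by [].
by rewrite -hs; exists (val a) => //=; exact: valP.
Qed.

Lemma aut_inv_invariants a :
  a \in invariants delta -> aut_inv sigma a \in invariants delta.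
Proof.
move=> ha; have: [set` invariants delta] a by [].
by rewrite -hs => -[b hb <-]; rewrite aut_funK.
Qed.

Definition restr_fun (a : inv_alg delta) : inv_alg delta :=
  InvAlg (restr_in a).
Definition restr_inv (a : inv_alg delta) : inv_alg delta :=
  InvAlg (aut_inv_invariants (valP a)).

Fact restr_fun_linear : linear restr_fun.
Proof.
move=> k a b; apply: val_inj.
by rewrite -[LHS]/(sigma (val (k *: a + b))) !linearP.
Qed.
HB.instance Definition _ := GRing.isLinear.Build K (inv_alg delta)
  (inv_alg delta) _ restr_fun restr_fun_linear.

Fact restr_fun_monoid : monoid_morphism restr_fun.
Proof.
split; first by apply: val_inj; rewrite -[LHS]/(sigma (val 1)) !rmorph1.
move=> a b; apply: val_inj.
by rewrite -[LHS]/(sigma (val (a * b))) !rmorphM.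
Qed.
HB.instance Definition _ := GRing.isMonoidMorphism.Build (inv_alg delta)
  (inv_alg delta) restr_fun restr_fun_monoid.

Fact restr_funK : cancel restr_fun restr_inv.
Proof. by move=> a; apply: val_inj; rewrite /= aut_funK. Qed.
Fact restr_invK : cancel restr_inv restr_fun.
Proof. by move=> a; apply: val_inj; rewrite /= aut_invK. Qed.

(* sigma_delta, the restriction of sigma to A^delta, in Aut_K(A^delta). *)
Definition restr_aut : algAut (inv_alg delta) :=
  @AlgAut K (inv_alg delta) restr_fun restr_inv restr_funK restr_invK.

End Restriction.

Section Conjugate.
Variables (K : fieldType) (A : algType K).
Variables (sigma : algAut A) (d : derivation A).

Definition conj_fun (a : A) : A := sigma (d (aut_inv sigma a)).

Fact conj_fun_linear : linear conj_fun.
Proof.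
move=> k a b; rewrite /conj_fun.
have -> : aut_inv sigma (k *: a + b) = k *: aut_inv sigma a + aut_inv sigma b.
  by apply: (can_inj (@aut_funK K A sigma)); rewrite linearP /= !aut_invK.
by rewrite !linearP.
Qed.
HB.instance Definition _ := GRing.isLinear.Build K A A _ conj_fun
  conj_fun_linear.

Fact conj_funM a b : conj_fun (a * b) = conj_fun a * b + a * conj_fun b.
Proof.
rewrite /conj_fun.
have -> : aut_inv sigma (a * b) = aut_inv sigma a * aut_inv sigma b.
  by apply: (can_inj (@aut_funK K A sigma)); rewrite rmorphM /= !aut_invK.
by rewrite derM rmorphD !rmorphM /= !aut_invK.
Qed.

(* The derivation sigma d sigma^-1. *)
Definition conj_der : derivation A := @Derivation K A conj_fun conj_funM.

Lemma iter_conj n a : iter n conj_der a = sigma (iter n d (aut_inv sigma a)).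
Proof.
elim: n => [|n IH] /=; first by rewrite aut_invK.
by rewrite IH /conj_fun aut_funK.
Qed.

Lemma conj_der_nilp : locally_nilpotent d -> locally_nilpotent conj_der.
Proof.
move=> hd a; have [n hn] := hd (aut_inv sigma a).
by exists n; rewrite iter_conj hn raddf0.
Qed.

End Conjugate.

Section PhiPsi.
Variables (K : fieldType) (A : algType K).

(* The maps phi'_i and psi'_i attached to d = delta'_i and x = x'_i; the sums
   have finite support when d is locally nilpotent, see [phi_support] and
   [psi_support]. *)
Definition phi (d : derivation A) (x a : A) : A :=
  \sum_(k \in [set: nat]) ((-1) ^+ k / k`!%:R) *: (x ^+ k * iter k d a).
Definition psi (d : derivation A) (x a : A) : A :=
  \sum_(k \in [set: nat]) ((-1) ^+ k / k`!%:R) *: (iter k d a * x ^+ k).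

Variable s : nat.
Variables (d : 'I_s -> derivation A) (x : 'I_s -> A).

(* phi'_s \o ... \o phi'_1: the map phi'_1 is applied first. *)
Definition phi_sigma : A -> A :=
  \big[comp/idfun]_(i <- rev (enum 'I_s)) phi (d i) (x i).
(* psi'_1 \o ... \o psi'_s: the map psi'_s is applied first. *)
Definition psi_sigma : A -> A :=
  \big[comp/idfun]_(i <- enum 'I_s) psi (d i) (x i).

(* x_1^alpha_1 ... x_s^alpha_s; the x_i need not commute. *)
Definition mpow (alpha : {ffun 'I_s -> nat}) : A :=
  \prod_(i < s) x i ^+ alpha i.
(* d_1^alpha_1 \o ... \o d_s^alpha_s *)
Definition dpow (alpha : {ffun 'I_s -> nat}) : A -> A :=
  \big[comp/idfun]_(i < s) iter (alpha i) (d i).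
Definition mfact (alpha : {ffun 'I_s -> nat}) : nat :=
  \prod_(i < s) (alpha i)`!.

End PhiPsi.

Section WellDefined.
Variables (K : fieldType) (A : algType K).
Implicit Types (d e : derivation A) (x a : A).

Lemma iter_der0 d n : iter n d 0 = 0.
Proof. by elim: n => //= n ->; rewrite linear0. Qed.

Lemma iter_der_ge d a n k : iter n d a = 0 -> (n <= k)%N -> iter k d a = 0.
Proof. by move=> h /subnK <-; rewrite iterD h iter_der0. Qed.

Lemma nat_finsum (F : nat -> A) n : (forall k, (n <= k)%N -> F k = 0) ->
  finite_set [set k | F k != 0] /\
  \sum_(k \in [set: nat]) F k = \sum_(k < n) F k.
Proof.
move=> h; split.
  apply: (@sub_finite_set _ _ `I_n); last exact: finite_II.
  move=> k /= hk; rewrite ltnNge; apply: contra hk => /h ->; exact: eqxx.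
rewrite -(big_mkord xpredT F) (fsbigTE (seq_fset tt (index_iota 0 n))).
  rewrite (perm_big _ (seq_fset_perm _ _)) /= undup_id ?iota_uniq //.
by move=> k; rewrite seq_fsetE mem_index_iota /= -leqNgt; exact: h.
Qed.

Lemma phi_support d x a : locally_nilpotent d ->
  finite_set [set k : nat |
    ((-1) ^+ k / k`!%:R : K) *: (x ^+ k * iter k d a) != 0].
Proof.
move=> /(_ a) [n hn]; apply: (proj1 (@nat_finsum _ n _)) => k hk.
by rewrite (iter_der_ge hn hk) mulr0 scaler0.
Qed.

Lemma psi_support d x a : locally_nilpotent d ->
  finite_set [set k : nat |
    ((-1) ^+ k / k`!%:R : K) *: (iter k d a * x ^+ k) != 0].
Proof.
move=> /(_ a) [n hn]; apply: (proj1 (@nat_finsum _ n _)) => k hk.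
by rewrite (iter_der_ge hn hk) mul0r scaler0.
Qed.

Lemma phiE d x a n : iter n d a = 0 ->
  phi d x a = \sum_(k < n) ((-1) ^+ k / k`!%:R) *: (x ^+ k * iter k d a).
Proof.
move=> hn; apply: (proj2 (@nat_finsum _ n _)) => k hk.
by rewrite (iter_der_ge hn hk) mulr0 scaler0.
Qed.

Lemma psiE d x a n : iter n d a = 0 ->
  psi d x a = \sum_(k < n) ((-1) ^+ k / k`!%:R) *: (iter k d a * x ^+ k).
Proof.
move=> hn; apply: (proj2 (@nat_finsum _ n _)) => k hk.
by rewrite (iter_der_ge hn hk) mul0r scaler0.
Qed.

Lemma der_exp1 d x k : d x = 1 -> d (x ^+ k.+1) = x ^+ k *+ k.+1.
Proof.
move=> h; elim: k => [|k IH]; first by rewrite expr1 h.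
by rewrite exprS derM h IH mul1r mulrnAr -exprS -mulrS.
Qed.

Lemma der_exp0 d x k : d x = 0 -> d (x ^+ k) = 0.
Proof.
move=> h; elim: k => [|k IH]; first exact: der1.
by rewrite exprS derM h IH mul0r mulr0 addr0.
Qed.

Lemma phi_comm d e x a : locally_nilpotent d -> e x = 0 ->
  (forall b, e (d b) = d (e b)) -> e (phi d x a) = phi d x (e a).
Proof.
move=> /(_ a) [n hn] ex ed.
have it k b : e (iter k d b) = iter k d (e b) by elim: k => //= k <-.
rewrite (phiE x hn) (@phiE _ _ (e a) n) -?it ?hn ?linear0 // linear_sum.
by apply: eq_bigr => k _; rewrite linearZ /= derM der_exp0 // mul0r add0r it.
Qed.

Lemma psi_comm d e x a : locally_nilpotent d -> e x = 0 ->
  (forall b, e (d b) = d (e b)) -> e (psi d x a) = psi d x (e a).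
Proof.
move=> /(_ a) [n hn] ex ed.
have it k b : e (iter k d b) = iter k d (e b) by elim: k => //= k <-.
rewrite (psiE x hn) (@psiE _ _ (e a) n) -?it ?hn ?linear0 // linear_sum.
by apply: eq_bigr => k _; rewrite linearZ /= derM der_exp0 // mulr0 addr0 it.
Qed.

Lemma phi0 d x : phi d x 0 = 0.
Proof. by rewrite (@phiE _ _ _ 0) ?big_ord0. Qed.
Lemma psi0 d x : psi d x 0 = 0.
Proof. by rewrite (@psiE _ _ _ 0) ?big_ord0. Qed.

Hypothesis charK : [pchar K] =i pred0.

Lemma coefS k : ((-1) ^+ k.+1 / k.+1`!%:R : K) *+ k.+1 = - ((-1) ^+ k / k`!%:R).
Proof.
have nz m : (m.+1%:R : K) != 0 by rewrite (proj1 (pcharf0P K) charK).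
rewrite exprS mulN1r mulNr mulNrn -[X in - X = _]mulr_natr factS natrM invfM.
by rewrite mulrA mulrAC divfK.
Qed.

Lemma der_phi d x a : locally_nilpotent d -> d x = 1 -> d (phi d x a) = 0.
Proof.
move=> /(_ a) [n hn] dx; rewrite (phiE x (iter_der_ge hn (leqnSn n))) linear_sum.
pose c (k : nat) : A := ((-1) ^+ k / k`!%:R : K) *: (x ^+ k * iter k.+1 d a).
rewrite (eq_bigr (fun k : 'I_n.+1 => c k - (if (k : nat) is k'.+1 then c k' else 0))).
  rewrite -(big_mkord xpredT (fun k => c k - (if (k : nat) is k'.+1 then c k' else 0))).
  rewrite sumrB big_nat_recr //= big_nat_recl //= add0r.
  by rewrite addrAC subrr add0r /c /= hn linear0 mulr0 scaler0.
case=> -[|k] hk _ /=; rewrite linearZ /= derM.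
  by rewrite /c expr0 der1 mul0r add0r subr0.
rewrite der_exp1 // scalerDr addrC /c; congr (_ + _).
by rewrite mulrnAl -scalerMnr scalerMnl coefS scaleNr.
Qed.

Lemma der_psi d x a : locally_nilpotent d -> d x = 1 -> d (psi d x a) = 0.
Proof.
move=> /(_ a) [n hn] dx; rewrite (psiE x (iter_der_ge hn (leqnSn n))) linear_sum.
pose c (k : nat) : A := ((-1) ^+ k / k`!%:R : K) *: (iter k.+1 d a * x ^+ k).
rewrite (eq_bigr (fun k : 'I_n.+1 => c k - (if (k : nat) is k'.+1 then c k' else 0))).
  rewrite -(big_mkord xpredT (fun k => c k - (if (k : nat) is k'.+1 then c k' else 0))).
  rewrite sumrB big_nat_recr //= big_nat_recl //= add0r.
  by rewrite addrAC subrr add0r /c /= hn linear0 mul0r scaler0.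
case=> -[|k] hk _ /=; rewrite linearZ /= derM.
  by rewrite /c expr0 der1 mulr0 addr0 subr0.
rewrite der_exp1 // scalerDr /c; congr (_ + _).
by rewrite mulrnAr -scalerMnr scalerMnl coefS scaleNr.
Qed.

Variables (s : nat) (d : 'I_s -> derivation A) (x : 'I_s -> A).
Hypothesis dnil : forall i, locally_nilpotent (d i).
Hypothesis dcomm : forall i j a, d i (d j a) = d j (d i a).
Hypothesis dx : forall i j, d i (x j) = (i == j)%:R.

Lemma der_phis (r : seq 'I_s) i a : i \in r ->
  d i ((\big[comp/idfun]_(j <- r) phi (d j) (x j)) a) = 0.
Proof.
elim: r a => // j r IH a; rewrite inE big_cons /=.
have [<- _|ne /= /IH h] := eqVneq i j.
  by apply: der_phi => //; rewrite dx eqxx.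
by rewrite phi_comm ?h ?phi0 // dx (negPf ne).
Qed.

Lemma der_psis (r : seq 'I_s) i a : i \in r ->
  d i ((\big[comp/idfun]_(j <- r) psi (d j) (x j)) a) = 0.
Proof.
elim: r a => // j r IH a; rewrite inE big_cons /=.
have [<- _|ne /= /IH h] := eqVneq i j.
  by apply: der_psi => //; rewrite dx eqxx.
by rewrite psi_comm ?h ?psi0 // dx (negPf ne).
Qed.

End WellDefined.

Section Image.
Variables (K : fieldType) (charK : [pchar K] =i pred0) (A : algType K).
Variables (s : nat) (delta : 'I_s -> derivation A) (x : 'I_s -> A).
Hypothesis dnil : forall i, locally_nilpotent (delta i).
Hypothesis dcomm : forall i j a, delta i (delta j a) = delta j (delta i a).
Hypothesis dx : forall i j, delta i (x j) = (i == j)%:R.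
Variable sigma : algAut A.
Hypothesis hs : stabilizes delta sigma.

Let delta' i := conj_der sigma (delta i).
Let x' i := sigma (x i).

Let nil' i : locally_nilpotent (delta' i).
Proof. exact: conj_der_nilp. Qed.
Let comm' i j a : delta' i (delta' j a) = delta' j (delta' i a).
Proof. by rewrite /= /conj_fun !aut_funK dcomm. Qed.
Let dx' i j : delta' i (x' j) = (i == j)%:R.
Proof. by rewrite /= /conj_fun aut_funK dx rmorph_nat. Qed.

Let inv' a : (forall i, delta' i a = 0) -> a \in invariants delta.
Proof.
move=> h; rewrite -(aut_invK sigma a).
have ha : aut_inv sigma a \in invariants delta.
  apply/invariantsP => i; apply: (can_inj (@aut_funK K A sigma)).
  by rewrite raddf0; exact: h.
exact: (restr_in hs (InvAlg ha)).
Qed.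

(* The values of phi_sigma and psi_sigma lie in A^delta, so that [to_inv]
   never takes its default value on them. *)
Lemma phi_sigma_inv a : phi_sigma delta' x' a \in invariants delta.
Proof. by apply: inv' => i; apply: der_phis; rewrite // mem_rev mem_enum. Qed.

Lemma psi_sigma_inv a : psi_sigma delta' x' a \in invariants delta.
Proof. by apply: inv' => i; apply: der_psis; rewrite // mem_enum. Qed.

End Image.

(* Main.v *)
(** Applying sigma turns the claim into the Taylor formulas
    [a = sum_alpha x'^alpha phi_sigma ((delta')^alpha a / alpha!)] and its
    mirror image.  Both are instances of one statement about linear operators:
    if [P_i = sum_k (-1)^k/k! E_i^k D_i^k], where [E_i] is left (resp. right)
    multiplication by [x'_i], then [sum_k E_i^k P_i D_i^k / k! = id], because
    the coefficient of [E_i^n D_i^n] in this double sum is [(1 - 1)^n / n!].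
    Since [P_i] commutes with [D_j] for [j <> i], the one-variable identities
    nest, the first index being outermost; the [E_i] need not commute.  Right
    multiplication reverses the order of composition, so for psi the indices
    are listed in decreasing order. *)

From HB Require Import structures.
Require Import Defs.
From mathcomp Require Import all_boot all_order all_algebra.
From mathcomp Require Import finmap boolp classical_sets.
From mathcomp Require Import cardinality fsbigop ring.

Set Implicit Arguments.
Unset Strict Implicit.
Unset Printing Implicit Defensive.

Import GRing.Theory.
Local Open Scope ring_scope.

(** * Finitely supported sums *)

Lemma is_finsum_ffun (I : finType) (V : nmodType) (N : nat)
    (F : {ffun I -> nat} -> V) :
  (forall (alpha : {ffun I -> nat}) i, (N < alpha i)%N -> F alpha = 0) ->
  is_finsum F (\sum_(f : {ffun I -> 'I_N.+1}) F [ffun i => f i : nat]).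
Proof.
(* [X] collects the multi-indices with all entries at most [N]. Since [F] vanishes off [X], the sum
   becomes one over a finite type. *)
move=> F0; pose e (f : {ffun I -> 'I_N.+1}) := [ffun i => f i : nat].
pose X := [fset e f | f in {ffun I -> 'I_N.+1}]%fset.
have F0X alpha : alpha \notin X -> F alpha = 0.
  move=> aX; have [/forallP le_aN|/forallPn[i]] :=
    boolP [forall i, (alpha i <= N)%N]; last by rewrite -ltnNge; exact: F0.
  case/imfsetP: aX; exists [ffun i => inord (alpha i)] => //.
  by apply/ffunP => i; rewrite !ffunE inordK ?ltnS.
have e_inj : injective e.
  by move=> f g /ffunP eq_fg; apply/ffunP => i; apply/val_inj;
    have := eq_fg i; rewrite !ffunE.
split; last first.
  rewrite (fsbigTE _ _ F0X) big_imfset /=; last by move=> f g _ _; exact: e_inj.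
  by rewrite big_enum.
apply: (@sub_finite_set _ _ [set` X]) (finite_fset _).
by move=> alpha /= Fa; apply: contraNT Fa => /F0X ->.
Qed.

(** The sums are compared after applying the injective [f], so that only [f] has to be additive:
    [aut_inv] is a bare function. *)
Lemma is_finsum_preim (I : choiceType) (V W : nmodType)
    (f : {additive V -> W}) (g : W -> V) (F : I -> V) (G : I -> W) (w : W) :
  cancel f g -> cancel g f -> (forall i, f (F i) = G i) -> is_finsum G w ->
  is_finsum F (g w).
Proof.
move=> fK gK fF [finG ->]; have f_eq0 v : (f v == 0) = (v == 0).
  by rewrite -(inj_eq (can_inj fK)) raddf0.
have eq_supp : [set i | F i != 0]%classic = [set i | G i != 0]%classic.
  by apply/funext => i /=; rewrite -fF f_eq0.
have finF : finite_set [set i | F i != 0]%classic by rewrite eq_supp.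
have F0 i : i \notin fset_set [set i | F i != 0]%classic -> F i = 0.
  by move=> h; apply/eqP; apply: contraNT h => Fi; rewrite in_fset_set // in_setE.
split=> //; apply: (can_inj fK); rewrite gK (fsbigTE _ _ F0) raddf_sum /=.
rewrite (fsbigTE (fset_set [set i | F i != 0]%classic)).
  by apply: eq_bigr => i _; rewrite fF.
by move=> i /F0; rewrite -fF => ->; rewrite raddf0.
Qed.

Fact iter_is_linear (K : pzRingType) (V : lmodType K) (f : {linear V -> V}) n :
  linear (iter n f).
Proof. by move=> c u v; elim: n => //= n ->; rewrite linearP. Qed.
HB.instance Definition _ (K : pzRingType) (V : lmodType K)
    (f : {linear V -> V}) n :=
  GRing.isLinear.Build K V V *:%R (iter n f) (iter_is_linear f n).

(** * Inversion for one pair of operators *)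

Section Taylor.
Variables (K : fieldType) (charK : [pchar K] =i pred0) (V : lmodType K).

Lemma natr_fact_neq0 n : n`!%:R != 0 :> K.
Proof. by rewrite (proj1 (pcharf0P K) charK) -lt0n fact_gt0. Qed.

(** Expand [(-1 + 1) ^+ n] and divide by [n!], which is invertible in characteristic zero. *)
Lemma sum_sign_fact n :
  \sum_(k < n.+1) ((k`!%:R)^-1 * ((-1) ^+ (n - k) / (n - k)`!%:R) : K)
    = (n == 0)%:R.
Proof.
have := exprDn (-1 : K) 1 n; rewrite addNr expr0n => E.
apply: (mulfI (natr_fact_neq0 n)); rewrite mulr_sumr.
transitivity ((n == 0)%:R : K); last first.
  by case: n {E} => [|n]; rewrite ?mulr0 // mul1r.
rewrite E; apply: eq_bigr => k _; rewrite expr1n mulr1.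
have kn : (k <= n)%N by rewrite -ltnS.
rewrite -(bin_fact kn) !natrM -[RHS]mulr_natr.
have := natr_fact_neq0 k; have := natr_fact_neq0 (n - k).
by move=> y0 x0; field; rewrite y0 x0.
Qed.

(** In [P] every [E] stands to the left of every [D], so the double sum has terms in
    [iter n E (iter n D b)] without commuting anything. The premise on [P] lets each value be
    truncated at its own bound. *)
Lemma taylor_inversion (E D : {linear V -> V}) (P : V -> V) N b :
  (forall n a, iter n D a = 0 ->
    P a = \sum_(k < n) ((-1) ^+ k / k`!%:R) *: iter k E (iter k D a)) ->
  iter N D b = 0 ->
  \sum_(k < N) (k`!%:R)^-1 *: iter k E (P (iter k D b)) = b.
Proof.
move=> PE DN.
pose G n := iter n E (iter n D b).
pose w k n : K := (k`!%:R)^-1 * ((-1) ^+ (n - k) / (n - k)`!%:R).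
(* Terms are collected by [n = k + j]. Nilpotency cuts the sum for [P (iter k D b)] at [j < N - k],
   which leaves the triangle [k <= n < N]. *)
transitivity (\sum_(0 <= n < N) \sum_(0 <= k < N | (k <= n)%N) w k n *: G n).
  rewrite -(big_mkord xpredT (fun k => k`!%:R^-1 *: iter k E (P (iter k D b)))).
  rewrite -(@exchange_big_dep_nat _ _ _ 0 N 0 N xpredT (fun k n => (k <= n)%N)) //.
  rewrite big_nat_cond [RHS]big_nat_cond.
  apply: eq_bigr => k /andP[/andP[_ ltkN] _].
  rewrite (PE (N - k)%N); last by rewrite -iterD subnK // ltnW.
  rewrite -(big_nat_widenl k 0 N xpredT) // (big_addn 0 N k xpredT) linear_sum.
  rewrite big_mkord scaler_sumr; apply: eq_bigr => j _.
  by rewrite linearZ /= scalerA /w addnK /G -iterD -iterD [(k + j)%N]addnC.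
have sumw n : (n < N)%N ->
    \sum_(0 <= k < N | (k <= n)%N) w k n *: G n = (n == 0)%:R *: G n.
  move=> ltnN; rewrite -sum_sign_fact scaler_suml.
  by rewrite -(big_nat_widen 0 n.+1 N xpredT) // big_mkord.
rewrite (eq_big_nat _ _ (fun n h => sumw n (proj2 (andP h)))).
(* For [N = 0] the sum is empty and [DN] says [b = 0]; otherwise only [G 0 = b] survives. *)
case: N DN {sumw} => [/= ->|N _]; first by rewrite big_nil.
by rewrite big_nat_recl //= scale1r big1 ?addr0 // => n _; rewrite scale0r.
Qed.

End Taylor.

(** * Inversion for several operators *)

Section MultiTaylor.
Variables (K : fieldType) (charK : [pchar K] =i pred0) (V : lmodType K).
Variables (I : finType) (E D : I -> {linear V -> V}) (P : I -> V -> V).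
Hypothesis Dcomm : forall i j a, D i (D j a) = D j (D i a).
Hypothesis PD : forall i j a, i != j -> D j (P i a) = P i (D j a).
Hypothesis PE : forall i n a, iter n (D i) a = 0 ->
  P i a = \sum_(k < n) ((-1) ^+ k / k`!%:R) *: iter k (E i) (iter k (D i) a).
Hypothesis PZ : forall i c a, P i (c *: a) = c *: P i a.

Lemma iter_comm m n i j a :
  iter m (D i) (iter n (D j) a) = iter n (D j) (iter m (D i) a).
Proof.
have comm1 b : iter m (D i) (D j b) = D j (iter m (D i) b).
  by elim: m => //= m ->.
by elim: n => //= n <-.
Qed.

Lemma iter_PD n i j a : i != j -> iter n (D j) (P i a) = P i (iter n (D j) a).
Proof. by move=> ne; elim: n => //= n ->; rewrite PD. Qed.

Lemma comp_PD (r : seq I) (alpha : I -> nat) i a : i \notin r ->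
  (\big[comp/idfun]_(j <- r) iter (alpha j) (D j)) (P i a) =
  P i ((\big[comp/idfun]_(j <- r) iter (alpha j) (D j)) a).
Proof.
elim: r => [|j r IH]; rewrite ?big_nil ?big_cons //= inE negb_or => /andP[ne ir].
by rewrite IH // iter_PD.
Qed.

Lemma big_comp_rcons (r : seq I) i (f : I -> V -> V) a :
  (\big[comp/idfun]_(j <- rcons r i) f j) a =
  (\big[comp/idfun]_(j <- r) f j) (f i a).
Proof.
by elim: r => [|j r IH]; rewrite ?big_nil ?big_cons /= ?big_cons ?big_nil //= IH.
Qed.

(** Induction on [r] with [b] varying: one-variable inversion for the head [i], then the induction
    hypothesis at [P i (iter k (D i) b)]. Multi-indices on [r] are functions on all of [I] vanishing
    off [r], which keeps the index type fixed. The reversal makes [P i] act first among the [P],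
    while [E i] acts last. *)
Lemma multi_taylor_inversion N (r : seq I) b :
  uniq r -> (forall i, i \in r -> iter N.+1 (D i) b = 0) ->
  \sum_(f : {ffun I -> 'I_N.+1} | [forall i, (i \notin r) ==> (f i == 0)])
    ((\prod_(i <- r) (f i)`!)%:R)^-1 *:
    (\big[comp/idfun]_(i <- r) iter (f i) (E i))
      ((\big[comp/idfun]_(i <- rev r) P i)
        ((\big[comp/idfun]_(i <- rev r) iter (f i) (D i)) b)) = b.
Proof.
elim: r b => [|i r IH] b.
  move=> _ _; rewrite (big_pred1 [ffun=> 0]); last first.
    move=> f; apply/forallP/eqP => [f0|-> i]; last by rewrite ffunE.
    by apply/ffunP => i; rewrite ffunE; apply/eqP; exact: f0.
  by rewrite !big_nil invr1 scale1r.
rewrite cons_uniq => /andP[ir Ur] DN.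
(* Split a multi-index into its [i]-entry [k] and the rest, supported on [r]. *)
rewrite (partition_big (fun f : {ffun I -> 'I_N.+1} => f i) xpredT) //.
rewrite -[RHS](taylor_inversion charK (@PE i) (DN i (mem_head _ _))).
apply: eq_bigr => k _.
(* [ext k] writes [k] at the entry [i] and [ext 0] erases it: they match multi-indices on [r] with
   those on [i :: r] whose [i]-entry is [k]. *)
pose ext (j0 : 'I_N.+1) (f : {ffun I -> 'I_N.+1}) :=
  [ffun j => if j == i then j0 else f j].
have DkN j : j \in r -> iter N.+1 (D j) (P i (iter k (D i) b)) = 0.
  move=> jr; have ne : i != j by apply: contraNneq ir => ->.
  rewrite iter_PD // iter_comm.
  rewrite (DN j) ?inE ?jr ?orbT // linear0.
  (* [P i 0 = 0], because at [0] even the empty truncation is allowed. *)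
  by rewrite (@PE i 0) // big_ord0.
rewrite -[P i (iter k (D i) b)](IH _ Ur DkN) linear_sum.
rewrite scaler_sumr (reindex_onto (ext k) (ext 0)) /=; last first.
  move=> f /andP[_ /eqP fi]; apply/ffunP => j; rewrite !ffunE.
  by case: eqP => // ->.
apply: eq_big => [g|g _].
  rewrite ffunE eqxx eqxx andbT; apply/andP/forallP => [[] | g0].
    move=> /forallP g0 /eqP <- j; rewrite !ffunE; apply/implyP => jr.
    by have := g0 j; rewrite ffunE inE negb_or jr andbT; case: eqP.
  split.
    apply/forallP => j; rewrite ffunE inE negb_or; apply/implyP.
    by case/andP=> /negPf-> jr; exact: (implyP (g0 j)).
  apply/eqP/ffunP => j; rewrite !ffunE; case: eqP => // ->.
  by apply/esym/eqP; exact: (implyP (g0 i)).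
have extr (j : I) : j \in r -> ext k g j = g j.
  by move=> jr; rewrite ffunE; case: eqP => // ji; rewrite -ji jr in ir.
rewrite rev_cons !big_comp_rcons !big_cons ffunE eqxx /=.
rewrite natrM invfM -scalerA; congr (_ *: _).
(* [P i] is exchanged with the powers of the [D j] for [j] in [r], all different from [i]. *)
rewrite -comp_PD ?mem_rev // linearZ; congr (_ *: iter k (E i) _).
  by congr (_%:R^-1); apply: eq_big_seq => j jr; rewrite extr.
rewrite (eq_big_seq (fun j => iter (g j) (E j))); last first.
  by move=> j jr; rewrite extr.
rewrite [X in (\big[_/_]_(_ <- rev r) P _) (X _)]
  (eq_big_seq (fun j => iter (g j) (D j))) // => j.
by rewrite mem_rev => jr; rewrite extr.
Qed.

Lemma comp_iter_comm m (r : seq I) (alpha : I -> nat) i a :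
  iter m (D i) ((\big[comp/idfun]_(j <- r) iter (alpha j) (D j)) a) =
  (\big[comp/idfun]_(j <- r) iter (alpha j) (D j)) (iter m (D i) a).
Proof.
elim: r => [|j r IH]; rewrite ?big_nil ?big_cons //=.
by rewrite iter_comm IH.
Qed.

Lemma comp_iter_rev (r : seq I) (alpha : I -> nat) a :
  (\big[comp/idfun]_(j <- rev r) iter (alpha j) (D j)) a =
  (\big[comp/idfun]_(j <- r) iter (alpha j) (D j)) a.
Proof.
elim: r a => [|j r IH] a; rewrite ?big_nil //.
by rewrite rev_cons big_comp_rcons big_cons /= IH comp_iter_comm.
Qed.

(** Commutation lets the vanishing power act on [a] first. *)
Lemma comp_iter_eq0 (r : seq I) (alpha : I -> nat) i a :
  i \in r -> iter (alpha i) (D i) a = 0 ->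
  (\big[comp/idfun]_(j <- r) iter (alpha j) (D j)) a = 0.
Proof.
have comp0 t : (\big[comp/idfun]_(j <- t) iter (alpha j) (D j)) 0 = 0.
  by elim: t => [|j t IH]; rewrite ?big_nil ?big_cons //= IH linear0.
elim: r => // j r IH; rewrite inE big_cons /= => /predU1P[<-|ir] a0.
  by rewrite comp_iter_comm a0 comp0.
by rewrite (IH ir a0) linear0.
Qed.

Lemma comp_PZ (r : seq I) c a :
  (\big[comp/idfun]_(j <- r) P j) (c *: a) =
  c *: (\big[comp/idfun]_(j <- r) P j) a.
Proof. by elim: r => [|j r IH]; rewrite ?big_nil ?big_cons //= IH PZ. Qed.

Lemma comp_EZ (r : seq I) (alpha : I -> nat) c a :
  (\big[comp/idfun]_(j <- r) iter (alpha j) (E j)) (c *: a) =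
  c *: (\big[comp/idfun]_(j <- r) iter (alpha j) (E j)) a.
Proof. by elim: r => [|j r IH]; rewrite ?big_nil ?big_cons //= IH linearZ. Qed.

(** [r] is any enumeration of [I], since the order of the [E i] matters and the two formulas use
    opposite orders. As [I] is finite, one [N] bounds the nilpotency orders of [a] under all [D i],
    so terms with an entry above [N] vanish. *)
Lemma multi_taylor_finsum (r : seq I) a :
  perm_eq r (index_enum I) -> (forall i, exists n, iter n (D i) a = 0) ->
  is_finsum (fun alpha : {ffun I -> nat} =>
    (\big[comp/idfun]_(i <- r) iter (alpha i) (E i))
      ((\big[comp/idfun]_(i <- rev r) P i)
        ((\prod_i (alpha i)`!)%:R^-1 *:
          (\big[comp/idfun]_(i <- r) iter (alpha i) (D i)) a))) a.
Proof.
move=> r_enum /fin_all_exists[n Dn].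
have r_all i : i \in r by rewrite (perm_mem r_enum) mem_index_enum.
have Ur : uniq r by rewrite (perm_uniq r_enum) index_enum_uniq.
pose N := \max_i n i.
have DN i m : (N <= m)%N -> iter m (D i) a = 0.
  move=> le_Nm; have /subnK <- : (n i <= m)%N.
    by apply: leq_trans le_Nm; exact: leq_bigmax.
  by rewrite iterD Dn linear0.
have E0 (alpha : I -> nat) :
    (\big[comp/idfun]_(i <- r) iter (alpha i) (E i)) 0 = 0.
  by rewrite -(scale0r 0) comp_EZ !scale0r.
have P0 : (\big[comp/idfun]_(i <- rev r) P i) 0 = 0.
  by rewrite -(scale0r 0) comp_PZ !scale0r.
(* [F] takes plain functions, so that bounded and unbounded multi-indices feed the same
   expression. *)
pose F (alpha : I -> nat) :=
  (\big[comp/idfun]_(i <- r) iter (alpha i) (E i))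
    ((\big[comp/idfun]_(i <- rev r) P i)
      ((\prod_i (alpha i)`!)%:R^-1 *:
        (\big[comp/idfun]_(i <- r) iter (alpha i) (D i)) a)).
have Fsum : a = \sum_(f : {ffun I -> 'I_N.+1}) F [ffun i => f i : nat].
  have DN1 i : i \in r -> iter N.+1 (D i) a = 0 by move=> _; exact: DN.
  rewrite -[LHS](multi_taylor_inversion Ur DN1).
  apply: eq_big => [f|f _]; first by apply/forallP => i; rewrite r_all.
  transitivity (F (fun i => f i)).
    by rewrite /F comp_PZ comp_EZ comp_iter_rev (perm_big _ r_enum).
  by congr (F _); apply/funext => i; rewrite ffunE.
rewrite [X in is_finsum _ X]Fsum.
apply: (@is_finsum_ffun _ _ N (fun alpha : {ffun I -> nat} => F alpha)).
move=> alpha i lt_N.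
rewrite /F (@comp_iter_eq0 r alpha i) ?DN ?(ltnW lt_N) //.
by rewrite scaler0 P0 E0.
Qed.

End MultiTaylor.

(** * Left and right multiplications by the [x i] as the operators [E i] *)

Section Algebra.
Variables (K : fieldType) (charK : [pchar K] =i pred0) (A : algType K).
Variables (s : nat) (d : 'I_s -> derivation A) (x : 'I_s -> A).
Hypothesis dnil : forall i, locally_nilpotent (d i).
Hypothesis dcomm : forall i j a, d i (d j a) = d j (d i a).
Hypothesis dx : forall i j, d i (x j) = (i == j)%:R.

Lemma iter_derZ i n c a : iter n (d i) (c *: a) = c *: iter n (d i) a.
Proof. exact: linearZ. Qed.

Lemma phiZ i c a : phi (d i) (x i) (c *: a) = c *: phi (d i) (x i) a.
Proof.
have [n dn] := dnil i a; rewrite (phiE _ dn) scaler_sumr (@phiE _ _ _ _ _ n).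
  by apply: eq_bigr => k _; rewrite iter_derZ -scalerAr !scalerA mulrC.
by rewrite iter_derZ dn scaler0.
Qed.

Lemma psiZ i c a : psi (d i) (x i) (c *: a) = c *: psi (d i) (x i) a.
Proof.
have [n dn] := dnil i a; rewrite (psiE _ dn) scaler_sumr (@psiE _ _ _ _ _ n).
  by apply: eq_bigr => k _; rewrite iter_derZ -scalerAl !scalerA mulrC.
by rewrite iter_derZ dn scaler0.
Qed.

Lemma iter_mull (z a : A) n : iter n (z \*o idfun) a = z ^+ n * a.
Proof. exact: iter_mulr. Qed.

Lemma iter_mulr_right (z a : A) n : iter n (z \o* idfun) a = a * z ^+ n.
Proof.
by elim: n => [|n IH]; rewrite ?mulr1 // iterS IH /= exprSr mulrA.
Qed.

Lemma comp_mull (r : seq 'I_s) (alpha : 'I_s -> nat) a :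
  (\big[comp/idfun]_(i <- r) iter (alpha i) (x i \*o idfun)) a =
  (\prod_(i <- r) x i ^+ alpha i) * a.
Proof.
elim: r => [|i r IH]; rewrite ?big_nil ?big_cons /= ?mul1r //.
by rewrite iter_mull IH mulrA.
Qed.

(** The right multiplication applied last contributes the rightmost factor, hence the reversed
    list. *)
Lemma comp_mulr (r : seq 'I_s) (alpha : 'I_s -> nat) a :
  (\big[comp/idfun]_(i <- rev r) iter (alpha i) (x i \o* idfun)) a =
  a * \prod_(i <- r) x i ^+ alpha i.
Proof.
elim: r a => [|i r IH] a; rewrite ?big_nil ?mulr1 //.
by rewrite rev_cons big_comp_rcons big_cons IH iter_mulr_right mulrA.
Qed.

Lemma enum_ord_index : enum 'I_s = index_enum 'I_s.
Proof. by rewrite enumT [index_enum _]unlock. Qed.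

Lemma phi_taylor a :
  is_finsum (fun alpha : {ffun 'I_s -> nat} =>
    mpow x alpha * phi_sigma d x ((mfact alpha)%:R^-1 *: dpow d alpha a)) a.
Proof.
have := @multi_taylor_finsum K charK A _ (fun i => x i \*o idfun) d
  (fun i => phi (d i) (x i)) dcomm _ _ phiZ (index_enum 'I_s) a (perm_refl _)
  (fun i => dnil i a).
under [X in is_finsum X _]eq_fun do rewrite comp_mull.
rewrite /phi_sigma enum_ord_index; apply.
- by move=> i j b ne; apply: phi_comm => //; rewrite dx eq_sym (negPf ne).
- move=> i n b dn; rewrite (phiE _ dn); apply: eq_bigr => k _.
  by rewrite iter_mull.
Qed.

(** With [r] the decreasing enumeration, [rev r] has the order of [psi_sigma], and [comp_iter_rev]
    puts the commuting [d i] back into the order of [dpow]. *)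
Lemma psi_taylor a :
  is_finsum (fun alpha : {ffun 'I_s -> nat} =>
    psi_sigma d x ((mfact alpha)%:R^-1 *: dpow d alpha a) * mpow x alpha) a.
Proof.
have := @multi_taylor_finsum K charK A _ (fun i => x i \o* idfun) d
  (fun i => psi (d i) (x i)) dcomm _ _ psiZ (rev (index_enum 'I_s)) a _
  (fun i => dnil i a).
under [X in is_finsum X _]eq_fun do rewrite comp_mulr revK comp_iter_rev //.
rewrite /psi_sigma enum_ord_index; apply.
- by move=> i j b ne; apply: psi_comm => //; rewrite dx eq_sym (negPf ne).
- move=> i n b dn; rewrite (psiE _ dn); apply: eq_bigr => k _.
  by rewrite iter_mulr_right.
- by rewrite perm_rev.
Qed.

End Algebra.

Theorem theorem4p1 (K : fieldType) (charK : [pchar K] =i pred0)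
    (A : algType K) (s : nat)
    (delta : 'I_s -> derivation A) (x : 'I_s -> A)
    (delta_nilp : forall i, locally_nilpotent (delta i))
    (delta_comm : forall i j a, delta i (delta j a) = delta j (delta i a))
    (delta_x : forall i j, delta i (x j) = (i == j)%:R)
    (sigma : algAut A) (sigma_stab : stabilizes delta sigma) :
  let sigma_delta : algAut (inv_alg delta) := restr_aut sigma_stab in
  let x' i := sigma (x i) in
  let delta' i := conj_der sigma (delta i) in
  forall a : A,
    is_finsum (fun alpha : {ffun 'I_s -> nat} =>
      mpow x alpha * val (aut_inv sigma_delta (to_inv delta
        (phi_sigma delta' x' ((mfact alpha)%:R^-1 *: dpow delta' alpha a)))))
      (aut_inv sigma a) /\
    is_finsum (fun alpha : {ffun 'I_s -> nat} =>
      val (aut_inv sigma_delta (to_inv delta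
        (psi_sigma delta' x' ((mfact alpha)%:R^-1 *: dpow delta' alpha a))))
        * mpow x alpha)
      (aut_inv sigma a).
Proof.
move=> sigma_delta x' delta' a.
have nil' i : locally_nilpotent (delta' i) by exact: conj_der_nilp.
have comm' i j b : delta' i (delta' j b) = delta' j (delta' i b).
  by rewrite /= /conj_fun !aut_funK delta_comm.
have dx' i j : delta' i (x' j) = (i == j)%:R.
  by rewrite /= /conj_fun aut_funK delta_x rmorph_nat.
have mpow' alpha : sigma (mpow x alpha) = mpow x' alpha.
  by rewrite rmorph_prod; apply: eq_bigr => i _; rewrite rmorphXn.
(* It suffices to sum the images of the terms under [sigma], which are the terms of the Taylor
   formulas for [delta'] and [x']. *)
split; apply: (is_finsum_preim (@aut_funK _ _ sigma) (@aut_invK _ _ sigma)).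
(* [sigma] cancels the inverse of [sigma_delta], and [phi_sigma_inv] ensures that [to_inv] is not at
   its default value. *)
- move=> alpha; rewrite [LHS](rmorphM sigma) /= mpow' aut_invK to_invK //.
  exact: phi_sigma_inv.
- exact: phi_taylor.
- move=> alpha; rewrite [LHS](rmorphM sigma) /= mpow' aut_invK to_invK //.
  exact: psi_sigma_inv.
- exact: psi_taylor.
Qed.
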